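(* Fix $\psi\in\{0,\pi\}$. For $(K,L)\in\mathbb{R}^2$ consider solutions $(r_1,r_2)\in[0,1]^2$ of the system $$r_1=\frac{Kr_1+Lr_2\cos\psi}{2}\,W\Big(\sqrt{K^2r_1^2+L^2r_2^2+2KLr_1r_2\cos\psi}\Big),$$ $$r_2=\frac{Kr_2+Lr_1\cos\psi}{2}\,W\Big(\sqrt{K^2r_2^2+L^2r_1^2+2KLr_1r_2\cos\psi}\Big).$$ Then the parameter space $\{(K,L)\in\mathbb{R}^2\}$ splits into two regions: (a) In the region $K+L\cos\psi\le 2$ there is precisely one solution: the unsynchronized solution $(r_1,r_2)=(0,0)$. (b) In the region $K+L\cos\psi>2$ there are at least two solutions: the unsynchronized solution $(r_1,r_2)=(0,0)$ and the symmetric synchronized solution $(r_1,r_2)=(r,r)$ for some $r\in(0,1)$.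
   Context: Define $$V(x)=\frac{\int_0^{2\pi}\cos\theta\,e^{x\cos\theta}\,d\theta}{\int_0^{2\pi}e^{x\cos\theta}\,d\theta},\qquad W(x)=\frac{2V(x)}{x}\ \text{ for } x>0,\qquad W(0)=\lim_{x\downarrow0}W(x)=1.$$ The displayed system is the set of self-consistency equations for the stationary synchronization levels $r_1,r_2$ of the two-community noisy Kuramoto model without disorder, with internal coupling $K$, cross-community coupling $L$, equal community sizes, noise strength $1$, and phase difference $\psi=\psi_2-\psi_1$ between the two communities. *)

(* Defs.v *)
From Stdlib Require Import Reals.
From Coquelicot Require Import Coquelicot.
Open Scope R_scope.

Definition V (x : R) : R :=
  RInt (fun theta => cos theta * exp (x * cos theta)) 0 (2 * PI)
  / RInt (fun theta => exp (x * cos theta)) 0 (2 * PI).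

(* Only used on [0, +oo): the value at 0 is the limit of 2 V(x) / x as x
   decreases to 0, which is 1. *)
Definition W (x : R) : R :=
  if Req_EM_T x 0 then 1 else 2 * V x / x.

(* [K], [L]: internal and cross-community coupling; [psi]: phase difference
   between the communities; [r1], [r2]: synchronization levels. The radicands
   are nonnegative (they are at least (|K r1| - |L r2|)^2, resp.
   (|K r2| - |L r1|)^2), so the totality of [sqrt] is harmless. *)
Definition self_consistent (psi K L r1 r2 : R) : Prop :=
  0 <= r1 <= 1 /\ 0 <= r2 <= 1 /\
  r1 = (K * r1 + L * r2 * cos psi) / 2
       * W (sqrt (K ^ 2 * r1 ^ 2 + L ^ 2 * r2 ^ 2
                  + 2 * K * L * r1 * r2 * cos psi)) /\
  r2 = (K * r2 + L * r1 * cos psi) / 2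
       * W (sqrt (K ^ 2 * r2 ^ 2 + L ^ 2 * r1 ^ 2
                  + 2 * K * L * r1 * r2 * cos psi)).

(* Main.v *)
(** Integrating by parts over a period turns the weight [W] into
    [2 <sin^2>], where [<.>] is the mean with density proportional to
    [exp (x cos theta)]; a second integration by parts gives
    [1 - W x = x^2 / 3 <sin^4>], so that [0 < W x < 1] for [x <> 0].
    Since [cos psi = 1] or [-1], with [M = L cos psi] the radicands are the
    squares of [y1 = K r1 + M r2] and [y2 = K r2 + M r1].  The system
    [r_i = y_i / 2 * W |y_i|] then forces [y_i >= 2 r_i], strictly unless
    [y_i = 0]; adding up, [(K + M) (r1 + r2) >= 2 (r1 + r2)], which proves (a).
    For (b), the nonzero symmetric solutions are the zeros of
    [c / 2 * W (c r) - 1] with [c = K + M]; this is positive at [0] and, since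
    [V < 1], negative at [1]. *)
Require Import Defs.
From Stdlib Require Import Reals Lra.
From Coquelicot Require Import Coquelicot.
Open Scope R_scope.

(** Unnormalised form of the mean <g>; for [g = 1] it is the normaliser, 2 pi I_0(x). *)
Definition expcos_int (g : R -> R) (x : R) : R :=
  RInt (fun t => g t * exp (x * cos t)) 0 (2 * PI).

Lemma continuous_expcos (g : R -> R) (x t : R) :
  continuous g t -> continuous (fun t => g t * exp (x * cos t)) t.
Proof.
  intros Hg. apply (continuous_mult g); [exact Hg|].
  apply (ex_derive_continuous (V := R_NormedModule)). auto_derive. exact I.
Qed.

Lemma ex_RInt_expcos (g : R -> R) (x a b : R) :
  (forall t, continuous g t) -> ex_RInt (fun t => g t * exp (x * cos t)) a b.
Proof.
  intros Hg. apply (ex_RInt_continuous (V := R_CompleteNormedModule)).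
  intros t _. now apply continuous_expcos.
Qed.

Lemma expcos_int_comb (f g : R -> R) (c x : R) :
  (forall t, continuous f t) -> (forall t, continuous g t) ->
  expcos_int (fun t => f t - c * g t) x = expcos_int f x - c * expcos_int g x.
Proof.
  intros Hf Hg. unfold expcos_int.
  apply is_RInt_unique.
  apply is_RInt_ext with
    (fun t => minus (f t * exp (x * cos t)) (scal c (g t * exp (x * cos t)))).
  { intros t _. unfold minus, plus, opp, scal; simpl. unfold mult; simpl. ring. }
  apply (is_RInt_minus (V := R_NormedModule)).
  - apply (RInt_correct (V := R_CompleteNormedModule)). now apply ex_RInt_expcos.
  - apply (is_RInt_scal (V := R_NormedModule)).
    apply (RInt_correct (V := R_CompleteNormedModule)). now apply ex_RInt_expcos.
Qed.

(** Splitting at [PI] lets [g] vanish at 0, [PI] and [2 * PI], as the even powers of [sin] and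
    [1 - cos] do at some of these points. *)
Lemma expcos_int_pos (g : R -> R) (x : R) :
  (forall t, continuous g t) -> (forall t, 0 <= g t) ->
  (forall t, 0 < t < PI -> 0 < g t) -> 0 < expcos_int g x.
Proof.
  intros Hc H0 Hp. pose proof PI_RGT_0 as HPI. unfold expcos_int.
  rewrite <- (RInt_Chasles (V := R_CompleteNormedModule) _ 0 PI (2 * PI))
    by now apply ex_RInt_expcos.
  apply Rplus_lt_le_0_compat.
  - apply RInt_gt_0; [lra| |].
    + intros t Ht. apply Rmult_lt_0_compat; [now apply Hp|apply exp_pos].
    + intros t _. now apply continuous_expcos.
  - apply RInt_ge_0; [lra|now apply ex_RInt_expcos|].
    intros t _. apply Rmult_le_pos; [apply H0|left; apply exp_pos].
Qed.

(** Integration by parts over a period: the boundary terms cancel because [exp (x * cos t)] agrees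
    at 0 and [2 * PI]. *)
Lemma expcos_int_deriv (F g : R -> R) (x : R) :
  (forall t, is_derive (fun t => F t * exp (x * cos t)) t (g t * exp (x * cos t))) ->
  (forall t, continuous g t) -> F 0 = F (2 * PI) -> expcos_int g x = 0.
Proof.
  intros Hd Hc HF. apply is_RInt_unique.
  replace 0 with (minus (F (2 * PI) * exp (x * cos (2 * PI))) (F 0 * exp (x * cos 0)))
    at 2.
  - apply (is_RInt_derive (V := R_CompleteNormedModule)
             (fun t => F t * exp (x * cos t)) (fun t => g t * exp (x * cos t))).
    + intros t _. apply Hd.
    + intros t _. now apply continuous_expcos.
  - rewrite HF, cos_2PI, cos_0. unfold minus, plus, opp; simpl. ring.
Qed.

Ltac continuous_by_derive :=
  intros; apply (ex_derive_continuous (V := R_NormedModule)); auto_derive; exact I.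

Lemma expcos_int_cos (x : R) :
  expcos_int cos x = x * expcos_int (fun t => sin t ^ 2) x.
Proof.
  apply Rminus_diag_uniq.
  rewrite <- expcos_int_comb by continuous_by_derive.
  apply expcos_int_deriv with sin.
  - intros t. auto_derive; [exact I|ring].
  - continuous_by_derive.
  - now rewrite sin_0, sin_2PI.
Qed.

Lemma expcos_int_sin2 (x : R) :
  expcos_int (fun _ => 1) x - 2 * expcos_int (fun t => sin t ^ 2) x
  = x ^ 2 / 3 * expcos_int (fun t => sin t ^ 4) x.
Proof.
  apply Rminus_diag_uniq.
  rewrite <- !expcos_int_comb by continuous_by_derive.
  (* Differentiating the [sin t * cos t] term leaves [- x * sin t ^ 2 * cos t]; the cubic term
     cancels it and contributes [- x ^ 2 / 3 * sin t ^ 4]. *)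
  apply expcos_int_deriv with (fun t => sin t * cos t + x / 3 * sin t ^ 3).
  - intros t. auto_derive; [exact I|].
    replace (1 - 2 * sin t ^ 2) with (cos t ^ 2 - sin t ^ 2).
    + field.
    + pose proof (sin2_cos2 t) as H. unfold Rsqr in H. nra.
  - continuous_by_derive.
  - now rewrite sin_0, sin_2PI, cos_0, cos_2PI.
Qed.

Lemma expcos_int_1_pos (x : R) : 0 < expcos_int (fun _ => 1) x.
Proof.
  apply expcos_int_pos; [continuous_by_derive|intros; lra..].
Qed.

Lemma expcos_int_sin_even_pos (n : nat) (x : R) :
  0 < expcos_int (fun t => sin t ^ (2 * n)) x.
Proof.
  apply expcos_int_pos; [continuous_by_derive| |].
  - intros t. rewrite pow_mult. apply pow_le, pow2_ge_0.
  - intros t Ht. apply pow_lt, sin_gt_0; tauto.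
Qed.

Lemma V_expcos (x : R) : V x = expcos_int cos x / expcos_int (fun _ => 1) x.
Proof.
  unfold V, expcos_int. f_equal. apply RInt_ext. intros t _. symmetry. apply Rmult_1_l.
Qed.

(** This form also covers [x = 0], where the right side of [expcos_int_sin2] vanishes; hence
    continuity of [W] at 0 needs no separate limit. *)
Lemma W_expcos (x : R) :
  W x = 2 * expcos_int (fun t => sin t ^ 2) x / expcos_int (fun _ => 1) x.
Proof.
  pose proof (expcos_int_1_pos x) as HD. unfold W.
  destruct (Req_EM_T x 0) as [->|Hx].
  - pose proof (expcos_int_sin2 0) as H.
    replace (2 * _) with (expcos_int (fun _ => 1) 0) by lra.
    field. lra.
  - rewrite V_expcos, expcos_int_cos. field. lra.
Qed.

Lemma W_0 : W 0 = 1.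
Proof. unfold W. destruct (Req_EM_T 0 0); [reflexivity|contradiction]. Qed.

Lemma W_pos (x : R) : 0 < W x.
Proof.
  rewrite W_expcos. apply Rdiv_lt_0_compat; [|apply expcos_int_1_pos].
  pose proof (expcos_int_sin_even_pos 1 x) as H; simpl Nat.mul in H. lra.
Qed.

Lemma W_lt_1 (x : R) : x <> 0 -> W x < 1.
Proof.
  intros Hx. rewrite W_expcos.
  pose proof (expcos_int_1_pos x) as HD. apply Rlt_div_l; [exact HD|].
  pose proof (expcos_int_sin2 x) as E.
  pose proof (expcos_int_sin_even_pos 2 x) as H; simpl Nat.mul in H.
  pose proof (pow2_gt_0 x Hx). nra.
Qed.

(** The left side equals [V x], even at 0, and [V x] is a mean of [cos], so [1 - V x] is a mean of
    [1 - cos], which is positive. *)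
Lemma half_W_lt_1 (x : R) : x / 2 * W x < 1.
Proof.
  pose proof (expcos_int_1_pos x) as HD.
  rewrite W_expcos.
  replace (_ * _) with (expcos_int cos x / expcos_int (fun _ => 1) x)
    by (rewrite expcos_int_cos; field; lra).
  apply Rlt_div_l; [exact HD|].
  assert (H : 0 < expcos_int (fun t => 1 - 1 * cos t) x).
  { apply expcos_int_pos; [continuous_by_derive| |].
    - intros t. pose proof (COS_bound t). lra.
    - intros t Ht. pose proof (cos_decreasing_1 0 t) as H. rewrite cos_0 in H. lra. }
  rewrite expcos_int_comb in H by continuous_by_derive. lra.
Qed.

Lemma continuity_expcos_int (g : R -> R) :
  (forall t, continuous g t) -> continuity (expcos_int g).
Proof.
  intros Hg x. apply continuity_pt_filterlim.
  apply (ex_derive_continuous (V := R_NormedModule)).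
  assert (Hd : forall y t,
    is_derive (fun z => g t * exp (z * cos t)) y (g t * (cos t * exp (y * cos t)))).
  { intros y t. auto_derive; [exact I|ring]. }
  (* Differentiation under the integral sign; the main condition is joint continuity of the partial
     derivative in [y]. *)
  eexists. apply (is_derive_RInt_param (fun y t => g t * exp (y * cos t))).
  - apply filter_forall. intros y t _. eexists. apply Hd.
  - intros t _.
    apply continuity_2d_pt_ext with (fun u v => g v * (cos v * exp (u * cos v))).
    { intros u v. symmetry. apply is_derive_unique, Hd. }
    apply continuity_2d_pt_mult.
    { apply (continuity_1d_2d_pt_comp g (fun _ v => v)).
      - apply continuity_pt_filterlim, Hg.
      - apply continuity_2d_pt_id2. }
    assert (Hcos : continuity_2d_pt (fun _ v => cos v) x t).
    { apply (continuity_1d_2d_pt_comp cos (fun _ v => v)).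
      - apply continuity_cos.
      - apply continuity_2d_pt_id2. }
    apply continuity_2d_pt_mult; [exact Hcos|].
    apply (continuity_1d_2d_pt_comp exp (fun u v => u * cos v)).
    + apply derivable_continuous, derivable_exp.
    + apply continuity_2d_pt_mult; [apply continuity_2d_pt_id1|exact Hcos].
  - apply filter_forall. intros y. now apply ex_RInt_expcos.
Qed.

Lemma continuity_W : continuity W.
Proof.
  intros x.
  apply continuity_pt_ext with
    (fun x => 2 * expcos_int (fun t => sin t ^ 2) x / expcos_int (fun _ => 1) x).
  { intros y. symmetry. apply W_expcos. }
  apply continuity_pt_div.
  - apply continuity_pt_scal. apply continuity_expcos_int. continuous_by_derive.
  - apply continuity_expcos_int. continuous_by_derive.
  - apply Rgt_not_eq, expcos_int_1_pos.
Qed.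

Lemma self_consistent_reduce (psi K L r1 r2 : R) : cos psi ^ 2 = 1 ->
  self_consistent psi K L r1 r2 <->
  0 <= r1 <= 1 /\ 0 <= r2 <= 1 /\
  r1 = (K * r1 + L * cos psi * r2) / 2 * W (Rabs (K * r1 + L * cos psi * r2)) /\
  r2 = (K * r2 + L * cos psi * r1) / 2 * W (Rabs (K * r2 + L * cos psi * r1)).
Proof.
  intros Hc. unfold self_consistent.
  assert (E : forall a b, K ^ 2 * a ^ 2 + L ^ 2 * b ^ 2 + 2 * K * L * a * b * cos psi
                = Rsqr (K * a + L * cos psi * b)).
  { intros a b. rewrite <- (Rmult_1_r (L ^ 2)), <- Hc. unfold Rsqr. ring. }
  rewrite <- !sqrt_Rsqr_abs, <- !E.
  replace (K * r1 + L * cos psi * r2) with (K * r1 + L * r2 * cos psi) by ring.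
  replace (K * r2 + L * cos psi * r1) with (K * r2 + L * r1 * cos psi) by ring.
  replace (2 * K * L * r2 * r1 * cos psi) with (2 * K * L * r1 * r2 * cos psi) by ring.
  reflexivity.
Qed.

(** As [W > 0], a negative [y] would make [r] negative; for positive [y], [W < 1] gives the strict
    bound. *)
Lemma W_fixed_lower_bound (r y : R) :
  0 <= r -> r = y / 2 * W (Rabs y) -> y = 0 \/ 2 * r < y.
Proof.
  intros Hr E. destruct (Req_dec y 0) as [->|Hy]; [now left|right].
  pose proof (W_pos (Rabs y)). pose proof (W_lt_1 (Rabs y) (Rabs_no_R0 y Hy)).
  assert (0 < y) by (destruct (Rtotal_order y 0) as [?|[?|?]]; [nra|lra|lra]).
  nra.
Qed.

Theorem theorem3p4 (psi : R) (Hpsi : psi = 0 \/ psi = PI) (K L : R) :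
  (K + L * cos psi <= 2 ->
     forall r1 r2 : R, self_consistent psi K L r1 r2 <-> (r1, r2) = (0, 0))
  /\
  (K + L * cos psi > 2 ->
     self_consistent psi K L 0 0 /\
     exists r : R, 0 < r < 1 /\ self_consistent psi K L r r).
Proof.
  assert (Hc : cos psi ^ 2 = 1).
  { destruct Hpsi as [->| ->]; rewrite ?cos_0, ?cos_PI; ring. }
  assert (H00 : self_consistent psi K L 0 0).
  { apply self_consistent_reduce; [exact Hc|].
    replace (K * 0 + L * cos psi * 0) with 0 by ring. lra. }
  split.
  - intros HK r1 r2. split; [|now intros [= -> ->]].
    rewrite self_consistent_reduce by exact Hc.
    set (M := L * cos psi) in *. intros (H1 & H2 & E1 & E2).
    assert (Hsum : (K * r1 + M * r2) + (K * r2 + M * r1) <= 2 * r1 + 2 * r2) by nra.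
    (* A vanishing argument forces its own [r] to vanish, so one strict bound already contradicts
       [Hsum]; only the case of two zero arguments survives. *)
    destruct (W_fixed_lower_bound _ _ (proj1 H1) E1) as [Y1|Y1];
    destruct (W_fixed_lower_bound _ _ (proj1 H2) E2) as [Y2|Y2];
      rewrite ?Y1 in E1; rewrite ?Y2 in E2; try (exfalso; lra).
    f_equal; lra.
  - intros HK. split; [exact H00|].
    set (c := K + L * cos psi) in *.
    (* Dividing the symmetric equation by [r] has removed the trivial root; the sign is chosen so
       that the function goes from negative to positive, as [IVT] expects. *)
    destruct (IVT (fun r => 1 - c / 2 * W (c * r)) 0 1) as (r & Hr & E).
    + intros r. apply continuity_pt_minus; [apply continuity_pt_const; easy|].
      apply continuity_pt_scal.
      apply (continuity_pt_comp (fun r => c * r) W); [|apply continuity_W].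
      apply continuity_pt_scal, continuity_pt_id.
    + lra.
    + rewrite Rmult_0_r, W_0. lra.
    + rewrite Rmult_1_r. pose proof (half_W_lt_1 c). lra.
    (* [IVT] locates the root only in the closed interval; the strict endpoint signs exclude 0 and
       1. *)
    + assert (r <> 0).
      { intros ->. rewrite Rmult_0_r, W_0 in E. lra. }
      assert (r <> 1).
      { intros ->. rewrite Rmult_1_r in E. pose proof (half_W_lt_1 c). lra. }
      exists r. split; [lra|].
      apply self_consistent_reduce; [exact Hc|].
      replace (K * r + L * cos psi * r) with (c * r) by (unfold c; ring).
      rewrite Rabs_pos_eq by nra.
      assert (r = c * r / 2 * W (c * r)) by nra. lra.
Qed.
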